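(* If $\Pi$ is a deduction in $\mathbf{I}$ in normal form, then every major premise of an application of an elimination rule in $\Pi$ is a (discharged or undischarged) assumption of $\Pi$.
   Context: Formulas of intuitionistic propositional logic are built from atomic formulas using the connectives $\bot$ (0-ary), $\land$, $\lor$, $\supset$; $\bot$ is not atomic. The natural deduction system $\mathbf{I}$ has tree-shaped deductions with assumptions at the leaves, grouped into assumption classes (occurrences of the same formula; a rule discharging a class discharges all its members). Rules: - $\land I$: from deductions of $A$, of $B$, and of $C$ from $[A\land B]$, conclude $C$. - $\supset I$: from a deduction of $B$ from $[A]$ and a deduction of $C$ from $[A\supset B]$, conclude $C$. - $\lor I$: from a deduction of $A$ (or of $B$) and a deduction of $C$ from $[A\lor B]$, conclude $C$. - $\land E$: from $A\land B$ and a deduction of $C$ from $[A],[B]$, conclude $C$. - $\supset E$: from $A\supset B$, $A$, and a deduction of $C$ from $[B]$, conclude $C$. - $\lor E$: from $A\lor B$, a deduction of $C$ from $[A]$ and one of $C$ from $[B]$, conclude $C$. - $\bot E$: from $\bot$ conclude $C$. A single assumption occurrence is a deduction. Standing conventions: no vacuous discharge above arbitrary premises; $\bot E$ has atomic conclusions. In elimination rules, $A\land B,A\supset B,A\lor B,\bot$ are the major premises and the $C$'s are arbitrary premises; in introduction rules the $C$ is the arbitrary premise and the discharged $A\land B, A\supset B, A\lor B$ are major assumptions discharged. A maximal formula with main operator $\ast$ is an occurrence of $A\ast B$ that is both the major premise of $\ast E$ and a major assumption discharged by $\ast I$. A segment is a sequence $C_1,\dots,C_n$ ($n>1$) of occurrences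 of the same formula, each $C_i$ ($i<n$) an arbitrary premise of a rule with conclusion $C_{i+1}$, and $C_n$ not an arbitrary premise. A maximal segment is a segment whose last formula is the major premise of an elimination rule. A deduction is in normal form if it contains no maximal formula and no maximal segment. *)

(* Defs.v *)
From Stdlib Require Import List Arith.
Import ListNotations.

Set Implicit Arguments.

Inductive form (atom : Type) : Type :=
| Atom (a : atom)
| Bot
| And (A B : form atom)
| Or (A B : form atom)
| Imp (A B : form atom).

Arguments Bot {atom}.

Definition atomic (atom : Type) (A : form atom) : Prop :=
  exists a, A = Atom a.

Inductive connective := cBot | cAnd | cOr | cImp.

(* [Intro cBot] names no rule of the system. *)
Inductive rule := Intro (c : connective) | Elim (c : connective).

(* An assumption class is a label together with a formula.  A rule binding the
   class (x, A) above one of its premises discharges every leaf [Ass x A] of the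
   subtree ending with that premise that is not already discharged inside it. *)
Definition class (atom : Type) : Type := (nat * form atom)%type.

(* Trees of formula occurrences built by putative rule applications; the side
   conditions relating the annotations to the subtrees are in [deduction].
   [A B] are the immediate subformulas of the formula introduced or eliminated,
   [C] is the conclusion, and each label precedes the subtree it binds in. *)
Inductive tree (atom : Type) : Type :=
| Ass (x : nat) (A : form atom)
| AndI (A B C : form atom) (d1 d2 : tree atom) (x : nat) (e : tree atom)
| ImpI (A B C : form atom) (x : nat) (d : tree atom) (y : nat) (e : tree atom)
| OrIl (A B C : form atom) (d : tree atom) (x : nat) (e : tree atom)
| OrIr (A B C : form atom) (d : tree atom) (x : nat) (e : tree atom)
| AndE (A B C : form atom) (d : tree atom) (x y : nat) (e : tree atom)
| ImpE (A B C : form atom) (d1 d2 : tree atom) (x : nat) (e : tree atom)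
| OrE (A B C : form atom) (d : tree atom)
    (x : nat) (e1 : tree atom) (y : nat) (e2 : tree atom)
| BotE (C : form atom) (d : tree atom).

Definition conclusion (atom : Type) (t : tree atom) : form atom :=
  match t with
  | Ass _ A => A
  | AndI _ _ C _ _ _ _ | ImpI _ _ C _ _ _ _
  | OrIl _ _ C _ _ _ | OrIr _ _ C _ _ _
  | AndE _ _ C _ _ _ _ | ImpE _ _ C _ _ _ _ | OrE _ _ C _ _ _ _ _
  | BotE C _ => C
  end.

Definition rule_of (atom : Type) (t : tree atom) : option rule :=
  match t with
  | Ass _ _ => None
  | AndI _ _ _ _ _ _ _ => Some (Intro cAnd)
  | ImpI _ _ _ _ _ _ _ => Some (Intro cImp)
  | OrIl _ _ _ _ _ _ | OrIr _ _ _ _ _ _ => Some (Intro cOr)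
  | AndE _ _ _ _ _ _ _ => Some (Elim cAnd)
  | ImpE _ _ _ _ _ _ _ => Some (Elim cImp)
  | OrE _ _ _ _ _ _ _ _ => Some (Elim cOr)
  | BotE _ _ => Some (Elim cBot)
  end.

(* [Minor] covers every premise that is neither major nor arbitrary. *)
Inductive role := Major | Minor | Arbitrary.

Record premise (atom : Type) : Type := Premise {
  prem_role : role;
  prem_form : form atom;               (* formula demanded by the rule *)
  prem_discharge : list (class atom);  (* classes the rule binds above it *)
  prem_tree : tree atom
}.

Definition premises (atom : Type) (t : tree atom) : list (premise atom) :=
  match t with
  | Ass _ _ => []
  | AndI A B C d1 d2 x e =>
      [Premise Minor A [] d1; Premise Minor B [] d2;
       Premise Arbitrary C [(x, And A B)] e]
  | ImpI A B C x d y e =>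
      [Premise Minor B [(x, A)] d; Premise Arbitrary C [(y, Imp A B)] e]
  | OrIl A B C d x e =>
      [Premise Minor A [] d; Premise Arbitrary C [(x, Or A B)] e]
  | OrIr A B C d x e =>
      [Premise Minor B [] d; Premise Arbitrary C [(x, Or A B)] e]
  | AndE A B C d x y e =>
      [Premise Major (And A B) [] d; Premise Arbitrary C [(x, A); (y, B)] e]
  | ImpE A B C d1 d2 x e =>
      [Premise Major (Imp A B) [] d1; Premise Minor A [] d2;
       Premise Arbitrary C [(x, B)] e]
  | OrE A B C d x e1 y e2 =>
      [Premise Major (Or A B) [] d; Premise Arbitrary C [(x, A)] e1;
       Premise Arbitrary C [(y, B)] e2]
  | BotE C d => [Premise Major Bot [] d]
  end.

(* A formula occurrence in a tree is the address of a node: the list of premise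
   indices on the path from the root (the end formula) to it. *)
Definition address := list nat.

Fixpoint subtree (atom : Type) (t : tree atom) (p : address) :
    option (tree atom) :=
  match p with
  | [] => Some t
  | i :: q =>
      match nth_error (premises t) i with
      | Some pr => subtree (prem_tree pr) q
      | None => None
      end
  end.

Definition formula_at (atom : Type) (t : tree atom) (p : address)
    (A : form atom) : Prop :=
  exists s, subtree t p = Some s /\ conclusion s = A.

Definition rule_at (atom : Type) (t : tree atom) (q : address) (r : rule) :
    Prop :=
  exists s, subtree t q = Some s /\ rule_of s = Some r.

(* [pr] is the [i]-th premise of the rule application concluding occurrence [q];
   the premise itself is the occurrence [q ++ [i]]. *)
Definition premise_at (atom : Type) (t : tree atom) (q : address) (i : nat)
    (pr : premise atom) : Prop :=
  exists s, subtree t q = Some s /\ nth_error (premises s) i = Some pr.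

Definition binds (atom : Type) (t : tree atom) (q : address) (i : nat)
    (a : class atom) : Prop :=
  exists pr, premise_at t q i pr /\ In a (prem_discharge pr).

Definition assumption_of_class (atom : Type) (t : tree atom) (p : address)
    (a : class atom) : Prop :=
  subtree t p = Some (Ass (fst a) (snd a)).

(* The assumption occurrence [p] is discharged by the rule application
   concluding [q], above its [i]-th premise: it is the innermost application on
   the path from [p] to the root that binds the class of [p]. *)
Definition discharged_by (atom : Type) (t : tree atom) (p q : address)
    (i : nat) : Prop :=
  exists s a,
    p = q ++ i :: s /\
    assumption_of_class t p a /\
    binds t q i a /\
    (forall s1 j s2, s = s1 ++ j :: s2 -> ~ binds t (q ++ i :: s1) j a).

Definition discharged_assumption (atom : Type) (t : tree atom) (p : address) :
    Prop :=
  exists q i, discharged_by t p q i.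

Definition undischarged_assumption (atom : Type) (t : tree atom)
    (p : address) : Prop :=
  (exists a, assumption_of_class t p a) /\ ~ discharged_assumption t p.

Definition undischarged_class (atom : Type) (t : tree atom) (a : class atom) :
    Prop :=
  exists p, assumption_of_class t p a /\ undischarged_assumption t p.

(* Conjunction elimination binds two classes above its arbitrary premise; its
   discharge is vacuous when both are empty. *)
Definition vacuous_discharge (atom : Type) (pr : premise atom) : Prop :=
  prem_discharge pr <> [] /\
  forall a, In a (prem_discharge pr) -> ~ undischarged_class (prem_tree pr) a.

Definition deduction (atom : Type) (t : tree atom) : Prop :=
  (forall q i pr, premise_at t q i pr ->
     conclusion (prem_tree pr) = prem_form pr /\
     (prem_role pr = Arbitrary -> ~ vacuous_discharge pr)) /\
  (forall q C, rule_at t q (Elim cBot) -> formula_at t q C -> atomic C).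

Definition major_premise_of (atom : Type) (t : tree atom) (c : connective)
    (p : address) : Prop :=
  exists q i pr,
    p = q ++ [i] /\ rule_at t q (Elim c) /\
    premise_at t q i pr /\ prem_role pr = Major.

Definition major_premise (atom : Type) (t : tree atom) (p : address) : Prop :=
  exists c, major_premise_of t c p.

(* [p] is an arbitrary premise of a rule application with conclusion [q]. *)
Definition arbitrary_premise_of (atom : Type) (t : tree atom)
    (p q : address) : Prop :=
  exists i pr,
    p = q ++ [i] /\ premise_at t q i pr /\ prem_role pr = Arbitrary.

Definition arbitrary_premise (atom : Type) (t : tree atom) (p : address) :
    Prop :=
  exists q, arbitrary_premise_of t p q.

(* The major assumption of an introduction is what it discharges above its
   arbitrary premise, unlike the antecedent that implication introduction
   discharges above its other premise. *)
Definition major_assumption_of (atom : Type) (t : tree atom) (c : connective)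
    (p : address) : Prop :=
  exists q i pr,
    rule_at t q (Intro c) /\ premise_at t q i pr /\
    prem_role pr = Arbitrary /\ discharged_by t p q i.

Definition maximal_formula (atom : Type) (t : tree atom) (p : address) :
    Prop :=
  exists c, major_premise_of t c p /\ major_assumption_of t c p.

Definition segment (atom : Type) (t : tree atom) (l : list address) : Prop :=
  1 < length l /\
  (exists C, forall p, In p l -> formula_at t p C) /\
  (forall k p q, nth_error l k = Some p -> nth_error l (S k) = Some q ->
     arbitrary_premise_of t p q) /\
  ~ arbitrary_premise t (last l []).

Definition maximal_segment (atom : Type) (t : tree atom) (l : list address) :
    Prop :=
  segment t l /\ major_premise t (last l []).

Definition normal (atom : Type) (t : tree atom) : Prop :=
  (forall p, ~ maximal_formula t p) /\ (forall l, ~ maximal_segment t l).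

(* Main.v *)
From Stdlib Require Import List Lia Classical.
Require Import Defs.
Import ListNotations.

(** A major premise that is not an assumption is the conclusion of a rule.  If
    the rule has an arbitrary premise, that premise followed by the major premise
    is a maximal segment.  The only rule without one is [BotE], whose conclusion
    is atomic, whereas no major premise is. *)

Lemma subtree_app (atom : Type) (t : tree atom) (p q : address) :
  subtree t (p ++ q) =
  match subtree t p with Some s => subtree s q | None => None end.
Proof.
  revert t; induction p as [|i p IH]; intros t; simpl; [reflexivity|].
  destruct (nth_error (premises t) i); [apply IH | reflexivity].
Qed.

Lemma subtree_premise (atom : Type) (t : tree atom) (q : address) (i : nat)
    (pr : premise atom) :
  premise_at t q i pr -> subtree t (q ++ [i]) = Some (prem_tree pr).
Proof.
  intros (s & Hs & Hi).
  now rewrite subtree_app, Hs; simpl; rewrite Hi.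
Qed.

(** The last index of a nonempty address and the part before it are determined by the address, so an
    occurrence is a premise of at most one rule application and has a single role there. *)
Lemma premise_at_inj (atom : Type) (t : tree atom) (q q' : address)
    (i i' : nat) (pr pr' : premise atom) :
  q ++ [i] = q' ++ [i'] ->
  premise_at t q i pr -> premise_at t q' i' pr' -> pr = pr'.
Proof.
  intros E (s & Hs & Hi) (s' & Hs' & Hi').
  apply app_inj_tail in E as [-> ->].
  congruence.
Qed.

Lemma major_premise_not_arbitrary (atom : Type) (t : tree atom) (p : address) :
  major_premise t p -> ~ arbitrary_premise t p.
Proof.
  intros (c & q & i & pr & -> & _ & Hpr & Hmaj) (q' & i' & pr' & E & Hpr' & Harb).
  pose proof (premise_at_inj _ _ _ _ _ _ _ _ E Hpr Hpr') as <-.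
  congruence.
Qed.

(** Every elimination demands a compound formula or [Bot] as its major premise, and [Bot] does not
    count as atomic. *)
Lemma major_prem_form_not_atomic (atom : Type) (t : tree atom)
    (pr : premise atom) :
  In pr (premises t) -> prem_role pr = Major -> ~ atomic (prem_form pr).
Proof.
  intros Hin Hmaj [a Ha].
  destruct t; simpl in Hin;
    repeat (destruct Hin as [<- | Hin]; [simpl in *; congruence|]);
    destruct Hin.
Qed.

Lemma deduction_major_premise_not_atomic (atom : Type) (t : tree atom)
    (p : address) (A : form atom) :
  deduction t -> major_premise t p -> formula_at t p A -> ~ atomic A.
Proof.
  intros [Hform _] (c & q & i & pr & -> & _ & Hpr & Hmaj) (s & Hs & <-).
  rewrite (subtree_premise _ _ _ _ _ Hpr) in Hs; injection Hs as <-.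
  rewrite (proj1 (Hform _ _ _ Hpr)).
  destruct Hpr as (u & _ & Hi).
  exact (major_prem_form_not_atomic _ _ _ (nth_error_In _ _ Hi) Hmaj).
Qed.

Lemma assumption_or_botE_or_arbitrary_premise (atom : Type) (t : tree atom) :
  (exists x A, t = Ass x A) \/ rule_of t = Some (Elim cBot) \/
  (exists i pr, nth_error (premises t) i = Some pr /\
     prem_role pr = Arbitrary /\ prem_form pr = conclusion t).
Proof.
  destruct t; simpl; eauto; right; right;
    (* The arbitrary premise has index 2 in [AndI] and [ImpE], where two other premises precede it;
       elsewhere index 1 works, for [OrE] as the first of two. *)
    ((exists 1; eexists; split; [reflexivity|]; now split) ||
     (exists 2; eexists; split; [reflexivity|]; now split)).
Qed.

(** Two occurrences already make a segment. It stops at [p] because a major premise is never an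
    arbitrary one. *)
Lemma arbitrary_premise_maximal_segment (atom : Type) (t s : tree atom)
    (p : address) (i : nat) (pr : premise atom) :
  deduction t -> major_premise t p -> subtree t p = Some s ->
  nth_error (premises s) i = Some pr -> prem_role pr = Arbitrary ->
  prem_form pr = conclusion s ->
  maximal_segment t [p ++ [i]; p].
Proof.
  intros [Hform _] Hmaj Hs Hi Harb HC.
  assert (Hpr : premise_at t p i pr) by (exists s; auto).
  split; [|exact Hmaj].
  split; [simpl; lia|]. split; [|split].
  - exists (conclusion s).
    intros r [<- | [<- | []]].
    + exists (prem_tree pr); split; [now apply subtree_premise|].
      rewrite <- HC; apply (Hform _ _ _ Hpr).
    + now exists s.
  - intros [|[|k]] r r' Hr Hr'; simpl in *; try discriminate.
    injection Hr as <-; injection Hr' as <-.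
    now exists i, pr.
  - now apply major_premise_not_arbitrary.
Qed.

Theorem theorem2 (atom : Type) (Pi : tree atom)
    (hded : deduction Pi) (hnorm : normal Pi) :
  forall p : address, major_premise Pi p ->
    discharged_assumption Pi p \/ undischarged_assumption Pi p.
Proof.
  intros p Hmaj.
  assert (Hs : exists s, subtree Pi p = Some s).
  { destruct Hmaj as (c & q & i & pr & -> & _ & Hpr & _).
    eexists; exact (subtree_premise _ _ _ _ _ Hpr). }
  destruct Hs as [s Hs].
  destruct (assumption_or_botE_or_arbitrary_premise _ s)
    as [(x & A & ->) | [Hbot | (i & pr & Hi & Harb & HC)]].
  (* The leaf is an assumption; excluded middle decides whether some application discharges it. *)
  - destruct (classic (discharged_assumption Pi p)) as [Hd | Hd]; [now left|].
    right; split; [now exists (x, A) | exact Hd].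
  - assert (HA : formula_at Pi p (conclusion s)) by now exists s.
    (* It remains to show that the conclusion of [BotE] is atomic, which is the second clause of
       [deduction]. *)
    destruct (deduction_major_premise_not_atomic _ _ _ _ hded Hmaj HA).
    apply (proj2 hded p); [now exists s | exact HA].
  - destruct (proj2 hnorm _
      (arbitrary_premise_maximal_segment _ _ _ _ _ _ hded Hmaj Hs Hi Harb HC)).
Qed.
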